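(* Let $G$ be a (not necessarily abelian) group and let $\mathcal{L}$ be a $G$-graded Lie algebra over a field $\mathbb{F}$ with homogeneous basis $\mathcal{B}=\{e_i\mid i\in N\}$ and structure constants $[e_i,e_j]=\sum_{k\in N}\alpha_{ij}^{(k)}e_k$. Let $\mathbb{F}_G(X_\mathcal{B})$ be the relatively free algebra in $\mathscr{V}_G$, freely generated by $X_\mathcal{B}=\{z_i\mid i\in N\}$ with $\deg z_i=\deg e_i$, and let $J_\mathcal{B}$ be the ideal of $\mathbb{F}_G(X_\mathcal{B})$ generated by all elements $z_iz_j-z_jz_i-\sum_{k\in N}\alpha_{ij}^{(k)}z_k$, $i,j\in N$. Then the strong $G$-graded universal enveloping algebra of $\mathcal{L}$ is $$\mathrm{SU}_G(\mathcal{L})=\mathbb{F}_G(X_\mathcal{B})/J_\mathcal{B},$$ with structure map $\mathcal{L}\to\mathbb{F}_G(X_\mathcal{B})/J_\mathcal{B}$ given by $e_i\mapsto z_i+J_\mathcal{B}$.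
   Context: A $G$-grading on an algebra $\mathcal{A}$ (associative or Lie) is a vector space decomposition $\mathcal{A}=\bigoplus_{g\in G}\mathcal{A}_g$ with $\mathcal{A}_g\mathcal{A}_h\subseteq\mathcal{A}_{gh}$ for all $g,h\in G$ (for a Lie algebra the product is the bracket). Nonzero elements of $\mathcal{A}_g$ are homogeneous of degree $g$. Homomorphisms are $G$-graded if they map degree-$g$ components into degree-$g$ components. $[g,h]$ denotes the group commutator. Associative algebras are unital and their homomorphisms preserve the unit. $\mathscr{V}_G$ is the variety of $G$-graded associative $\mathbb{F}$-algebras $\mathcal{A}$ satisfying $ab=0$ for all $a\in\mathcal{A}_g$, $b\in\mathcal{A}_h$ whenever $[g,h]\ne1$ (that is, the graded identities $x_1^{(g)}x_2^{(h)}=0$, $[g,h]\neq 1$). The relatively free algebra in $\mathscr{V}_G$ on a set $X$ of variables with assigned degrees in $G$ is the quotient of the free associative algebra $\mathbb{F}\langle X\rangle$ (graded by letting the degree of a monomial be the product, in order, of the degrees of its letters) by the ideal of all its elements that vanish under every $G$-graded homomorphism to an algebra of $\mathscr{V}_G$. A $G$-pair $(\mathcal{L},\mathcal{A})$ consists of a $G$-graded Lie algebra $\mathcal{L}$, a $G$-graded associative algebra $\mathcal{A}$, and a linear map $\iota:\mathcal{L}\to\mathcal{A}$ with $\iota(\mathcal{L}_g)\subseteq\mathcal{A}_g$ for all $g$ and $\iota([x,y])=\iota(x)\iota(y)-\iota(y)\iota(x)$. (The paper's convention at this stage: $\iota$ is only required to be a homomorphism, not necessarily injective.) It is a strong pair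 if the commutator makes $\mathcal{A}=\bigoplus_g\mathcal{A}_g$ a $G$-graded Lie algebra, i.e. $[\mathcal{A}_g,\mathcal{A}_h]\subseteq\mathcal{A}_{gh}$ for all $g,h$. The strong $G$-graded universal enveloping algebra of $\mathcal{L}$ is a strong pair $(\mathcal{L},\mathrm{SU}_G(\mathcal{L}))$ such that for every strong pair $(\mathcal{H},\mathcal{A})$, each $G$-graded Lie homomorphism $\mathcal{L}\to\mathcal{H}$ admits a unique extension to a $G$-graded algebra homomorphism $\mathrm{SU}_G(\mathcal{L})\to\mathcal{A}$ (commuting with the structure maps). It is unique up to isomorphism if it exists. *)

(* Defs.v *)
From HB Require Import structures.
From mathcomp Require Import all_boot all_algebra finmap boolp monalg.

Set Implicit Arguments.
Unset Strict Implicit.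
Unset Printing Implicit Defensive.

Import GRing.Theory.
Local Open Scope ring_scope.

(* Unital associative algebras over [F].  Unlike [algType F], the zero algebra
   is allowed. *)
HB.mixin Record Lmodule_isUnitalAlg (F : fieldType) A of GRing.Lmodule F A := {
  alg_one : A;
  alg_mul : A -> A -> A;
  alg_mulA : associative alg_mul;
  alg_mul1 : left_id alg_one alg_mul;
  alg_mulr1 : right_id alg_one alg_mul;
  alg_mul_linearl : forall z : A, linear (alg_mul^~ z);
  alg_mul_linearr : forall z : A, linear (alg_mul z)
}.

#[short(type="unitalAlgType")]
HB.structure Definition UnitalAlg (F : fieldType) :=
  {A of GRing.Lmodule F A & Lmodule_isUnitalAlg F A}.

Section UnitalAlgRing.
Variables (F : fieldType) (A : unitalAlgType F).

Fact alg_mulDl : left_distributive (@alg_mul F A) +%R.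
Proof.
by move=> x y z; have := alg_mul_linearl z 1 x y; rewrite !scale1r.
Qed.

Fact alg_mulDr : right_distributive (@alg_mul F A) +%R.
Proof.
by move=> x y z; have := alg_mul_linearr x 1 y z; rewrite !scale1r.
Qed.

HB.instance Definition _ := GRing.Zmodule_isPzRing.Build (UnitalAlg.sort A)
  alg_mulA alg_mul1 alg_mulr1 alg_mulDl alg_mulDr.

Fact unitalAlg_scaleAl (c : F) (x y : A) : c *: (x * y) = (c *: x) * y.
Proof.
have h := alg_mul_linearl y c x 0; rewrite addr0 in h.
have h0 := mul0r y; rewrite -[LHS]addr0 -[X in _ + X]h0; exact: esym.
Qed.

Fact unitalAlg_scaleAr (c : F) (x y : A) : c *: (x * y) = x * (c *: y).
Proof.
have h := alg_mul_linearr x c y 0; rewrite addr0 in h.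
have h0 := mulr0 x; rewrite -[LHS]addr0 -[X in _ + X]h0; exact: esym.
Qed.

End UnitalAlgRing.

HB.mixin Record Lmodule_isLieAlg (F : fieldType) L of GRing.Lmodule F L := {
  lie : L -> L -> L;
  lie_linearl : forall z : L, linear (lie^~ z);
  lie_linearr : forall z : L, linear (lie z);
  liexx : forall x : L, lie x x = 0;
  lie_jacobi : forall x y z : L,
    lie x (lie y z) + lie y (lie z x) + lie z (lie x y) = 0
}.

#[short(type="lieAlgType")]
HB.structure Definition LieAlg (F : fieldType) :=
  {L of GRing.Lmodule F L & Lmodule_isLieAlg F L}.

Definition commutator (A : pzRingType) (x y : A) : A := x * y - y * x.

Definition lie_hom (F : fieldType) (L H : lieAlgType F) (f : L -> H) : Prop :=
  linear f /\ {morph f : x y / lie x y >-> lie x y}.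

Definition alg_hom (F : fieldType) (A B : unitalAlgType F) (f : A -> B) : Prop :=
  linear f /\ monoid_morphism f.

Definition is_basis (F : fieldType) (V : lmodType F) (N : choiceType)
    (e : N -> V) : Prop :=
  forall x : V, exists! c : {fsfun N -> F with 0},
    x = \sum_(i <- finsupp c) c i *: e i.

Section Gradings.
Variables (G : groupType) (F : fieldType).

Record is_grading (V : lmodType F) (V_ : G -> V -> Prop) : Prop := IsGrading {
  grading0 : forall g, V_ g 0;
  gradingP : forall g (c : F) x y, V_ g x -> V_ g y -> V_ g (c *: x + y);
  grading_dec : forall x : V, exists! f : {fsfun G -> V with 0},
    (forall g, V_ g (f g)) /\ x = \sum_(g <- finsupp f) f g
}.

Definition graded_map (V W : lmodType F) (V_ : G -> V -> Prop)
    (W_ : G -> W -> Prop) (f : V -> W) : Prop :=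
  forall g x, V_ g x -> W_ g (f x).

Definition graded_lie (L : lieAlgType F) (L_ : G -> L -> Prop) : Prop :=
  is_grading L_ /\
  forall g h x y, L_ g x -> L_ h y -> L_ (g * h)%g (lie x y).

Definition graded_alg (A : unitalAlgType F) (A_ : G -> A -> Prop) : Prop :=
  is_grading A_ /\
  forall g h a b, A_ g a -> A_ h b -> A_ (g * h)%g (a * b).

Definition in_variety (A : unitalAlgType F) (A_ : G -> A -> Prop) : Prop :=
  graded_alg A_ /\
  forall g h, [~ g, h]%g <> 1%g ->
    forall a b, A_ g a -> A_ h b -> a * b = 0.

Record graded_pair (L : lieAlgType F) (L_ : G -> L -> Prop)
    (A : unitalAlgType F) (A_ : G -> A -> Prop) (iota : L -> A) : Prop :=
  GradedPair {
    pair_lie : graded_lie L_;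
    pair_alg : graded_alg A_;
    pair_linear : linear iota;
    pair_graded : graded_map L_ A_ iota;
    pair_bracket : {morph iota : x y / lie x y >-> commutator x y}
  }.

Definition strong_pair (L : lieAlgType F) (L_ : G -> L -> Prop)
    (A : unitalAlgType F) (A_ : G -> A -> Prop) (iota : L -> A) : Prop :=
  graded_pair L_ A_ iota /\
  forall g h a b, A_ g a -> A_ h b -> A_ (g * h)%g (commutator a b).

Definition strong_universal_enveloping (L : lieAlgType F) (L_ : G -> L -> Prop)
    (U : unitalAlgType F) (U_ : G -> U -> Prop) (iota : L -> U) : Prop :=
  strong_pair L_ U_ iota /\
  forall (H : lieAlgType F) (H_ : G -> H -> Prop)
         (A : unitalAlgType F) (A_ : G -> A -> Prop) (kappa : H -> A),
    strong_pair H_ A_ kappa ->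
    forall phi : L -> H, lie_hom phi -> graded_map L_ H_ phi ->
    exists! Phi : U -> A,
      [/\ alg_hom Phi, graded_map U_ A_ Phi
        & forall x, Phi (iota x) = kappa (phi x)].

End Gradings.

HB.mixin Record isTwoSided (R : pzRingType) (I : R -> bool) := {
  idealMl : forall a x : R, x \in I -> a * x \in I;
  idealMr : forall a x : R, x \in I -> x * a \in I
}.

(* Two-sided ideals, not necessarily proper. *)
#[short(type="idealType")]
HB.structure Definition TwoSidedIdeal (R : pzRingType) :=
  {I of isTwoSided R I & GRing.ZmodClosed R I}.

Section QuotientAlgebra.
Variables (F : fieldType) (A : unitalAlgType F) (I : idealType A).

Definition quotAlg := Quotient.quot I.
HB.instance Definition _ := GRing.Zmodule.on quotAlg.

Definition cls (x : A) : quotAlg := \pi_(Quotient.quot I)%qT x.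

Lemma cls_eqP (x y : A) : cls x = cls y <-> x - y \in I.
Proof.
rewrite /cls Quotient.idealrBE.
by split=> [/eqP|/eqP].
Qed.

Lemma cls_surj (q : quotAlg) : exists x, q = cls x.
Proof. by exists (repr q); rewrite /cls; exact: esym (reprK q). Qed.

Lemma cls_repr (x : A) : repr (cls x) - x \in I.
Proof. by apply/cls_eqP; rewrite /cls reprK. Qed.

Lemma clsD : {morph cls : x y / x + y}.
Proof. by move=> x y; exact: Quotient.pi_add. Qed.

Definition quot_one : quotAlg := cls 1.
Definition quot_mul (p q : quotAlg) : quotAlg := cls (repr p * repr q).
Definition quot_scale (c : F) (p : quotAlg) : quotAlg := cls (c *: repr p).

Lemma cls_mul x y : quot_mul (cls x) (cls y) = cls (x * y).
Proof.
apply/cls_eqP.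
have -> : repr (cls x) * repr (cls y) - x * y
   = (repr (cls x) - x) * repr (cls y) + x * (repr (cls y) - y).
  by rewrite mulrBl mulrBr addrA subrK.
by apply: rpredD; [apply: idealMr | apply: idealMl]; exact: cls_repr.
Qed.

Lemma cls_scale c x : quot_scale c (cls x) = cls (c *: x).
Proof.
apply/cls_eqP; rewrite -scalerBr -[X in c *: X]mul1r unitalAlg_scaleAl.
by apply: idealMl; exact: cls_repr.
Qed.

Fact quot_mulA : associative quot_mul.
Proof.
move=> p q r.
have [x ->] := cls_surj p; have [y ->] := cls_surj q; have [z ->] := cls_surj r.
by rewrite !cls_mul mulrA.
Qed.

Fact quot_mul1 : left_id quot_one quot_mul.
Proof. by move=> p; have [x ->] := cls_surj p; rewrite cls_mul mul1r. Qed.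

Fact quot_mulr1 : right_id quot_one quot_mul.
Proof. by move=> p; have [x ->] := cls_surj p; rewrite cls_mul mulr1. Qed.

Fact quot_mulDl : left_distributive quot_mul +%R.
Proof.
move=> p q r.
have [x ->] := cls_surj p; have [y ->] := cls_surj q; have [z ->] := cls_surj r.
by rewrite -clsD !cls_mul -clsD mulrDl.
Qed.

Fact quot_mulDr : right_distributive quot_mul +%R.
Proof.
move=> p q r.
have [x ->] := cls_surj p; have [y ->] := cls_surj q; have [z ->] := cls_surj r.
by rewrite -clsD !cls_mul -clsD mulrDr.
Qed.

Fact quot_scaleA a b p :
  quot_scale a (quot_scale b p) = quot_scale (a * b) p.
Proof. by have [x ->] := cls_surj p; rewrite !cls_scale scalerA. Qed.

Fact quot_scale1 : left_id 1 quot_scale.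
Proof. by move=> p; have [x ->] := cls_surj p; rewrite cls_scale scale1r. Qed.

Fact quot_scaleDr : right_distributive quot_scale +%R.
Proof.
move=> c p q; have [x ->] := cls_surj p; have [y ->] := cls_surj q.
by rewrite -clsD !cls_scale -clsD scalerDr.
Qed.

Fact quot_scaleDl p : {morph quot_scale^~ p : a b / a + b}.
Proof.
by move=> a b; have [x ->] := cls_surj p; rewrite !cls_scale -clsD scalerDl.
Qed.

HB.instance Definition _ := GRing.Zmodule_isLmodule.Build F quotAlg
  quot_scaleA quot_scale1 quot_scaleDr quot_scaleDl.

Fact quot_mul_linearl (z : quotAlg) : linear (quot_mul^~ z).
Proof.
move=> c p q; have [x ->] := cls_surj p; have [y ->] := cls_surj q.
have [t ->] := cls_surj z; rewrite quot_mulDl; congr (_ + _).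
change (quot_mul (quot_scale c (cls x)) (cls t)
        = quot_scale c (quot_mul (cls x) (cls t))).
by rewrite cls_scale !cls_mul cls_scale unitalAlg_scaleAl.
Qed.

Fact quot_mul_linearr (z : quotAlg) : linear (quot_mul z).
Proof.
move=> c p q; have [x ->] := cls_surj p; have [y ->] := cls_surj q.
have [t ->] := cls_surj z; rewrite quot_mulDr; congr (_ + _).
change (quot_mul (cls t) (quot_scale c (cls x))
        = quot_scale c (quot_mul (cls t) (cls x))).
by rewrite cls_scale !cls_mul cls_scale unitalAlg_scaleAr.
Qed.

HB.instance Definition _ := Lmodule_isUnitalAlg.Build F quotAlg
  quot_mulA quot_mul1 quot_mulr1 quot_mul_linearl quot_mul_linearr.
HB.instance Definition _ :=
  GRing.PzRing.copy quotAlg (UnitalAlg.sort quotAlg).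

Definition quot_comp (G : groupType) (A_ : G -> A -> Prop) (g : G)
    (q : quotAlg) : Prop :=
  exists2 x : A, A_ g x & q = cls x.

End QuotientAlgebra.

Section GeneratedIdeal.
Variables (R : pzRingType) (S : R -> Prop).

Definition gen_ideal : R -> bool := fun x =>
  `[< forall I : idealType R, (forall s, S s -> s \in I) -> x \in I >].

Fact gen_ideal_zmod : zmod_closed gen_ideal.
Proof.
split=> [|x y /asboolP xS /asboolP yS]; apply/asboolP=> I SI.
  exact: rpred0.
by rewrite rpredB ?xS ?yS.
Qed.

HB.instance Definition _ :=
  GRing.isZmodClosed.Build R gen_ideal gen_ideal_zmod.

Fact gen_idealMl (a x : R) : x \in gen_ideal -> a * x \in gen_ideal.
Proof.
by move=> /asboolP xS; apply/asboolP=> I SI; rewrite idealMl ?xS.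
Qed.

Fact gen_idealMr (a x : R) : x \in gen_ideal -> x * a \in gen_ideal.
Proof.
by move=> /asboolP xS; apply/asboolP=> I SI; rewrite idealMr ?xS.
Qed.

HB.instance Definition _ :=
  isTwoSided.Build R gen_ideal gen_idealMl gen_idealMr.

End GeneratedIdeal.

Section FreeAlgebra.
Variables (F : fieldType) (N : choiceType).

(* The monoid algebra of the free monoid of words in [N]. *)
Definition freeAlg := {malg F[{fmonom N}]}.
HB.instance Definition _ := GRing.Lmodule.on freeAlg.

Definition free_mul (p q : freeAlg) : freeAlg :=
  (p : {malg F[{fmonom N}]}) * q.

Fact free_mul_linearl (r : freeAlg) : linear (free_mul^~ r).
Proof. by move=> c p q; rewrite /free_mul mulrDl scalerAl. Qed.

Fact free_mul_linearr (r : freeAlg) : linear (free_mul r).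
Proof.
move=> c p q; rewrite /free_mul mulrDr; congr (_ + _); apply/malgP=> k.
rewrite mcoeffZ (mcoeffMlw _ (fsubset_refl _) (msuppZ_le _ _)) mcoeffMl.
rewrite big_distrr; apply: eq_bigr => k1 _.
rewrite big_distrr; apply: eq_bigr => k2 _ /=.
by rewrite mcoeffZ mulrnAr mulrCA.
Qed.

HB.instance Definition _ := Lmodule_isUnitalAlg.Build F freeAlg
  (@mulrA {malg F[{fmonom N}]}) (@mul1r {malg F[{fmonom N}]})
  (@mulr1 {malg F[{fmonom N}]}) free_mul_linearl free_mul_linearr.
(* The ring structure is the one induced by [unitalAlgType], so that ideals of
   [freeAlg] as a ring and as a unital algebra are the same type. *)
HB.instance Definition _ :=
  GRing.PzRing.copy freeAlg (UnitalAlg.sort freeAlg).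

Definition free_var (i : N) : freeAlg := << fmu i >>.

Variables (G : groupType) (d : N -> G).

Definition word_degree (m : {fmonom N}) : G :=
  (\big[*%g/1]_(i <- (m : seq N)) d i)%g.

Definition free_comp (g : G) (p : freeAlg) : Prop :=
  forall m, m \in msupp p -> word_degree m = g.

(* The graded identities, in variables [X_i] of degree [d i], holding in every
   algebra satisfying [in_variety]. *)
Definition variety_ideal : freeAlg -> bool := fun p =>
  `[< forall (A : unitalAlgType F) (A_ : G -> A -> Prop), in_variety A_ ->
      forall f : freeAlg -> A, alg_hom f -> graded_map free_comp A_ f ->
      f p = 0 >].

Fact variety_ideal_zmod : zmod_closed variety_ideal.
Proof.
split=> [|p q /asboolP pT /asboolP qT]; apply/asboolP=> A A_ vA f [lf mf] gf.
  by have := lf (-1) 0 0; rewrite scaler0 addr0 scaleN1r addNr.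
rewrite (_ : p - q = -1 *: q + p); last by rewrite scaleN1r addrC.
by rewrite lf (pT A A_) // (qT A A_) // scaler0 addr0.
Qed.

HB.instance Definition _ :=
  GRing.isZmodClosed.Build freeAlg variety_ideal variety_ideal_zmod.

Fact variety_idealMl (p q : freeAlg) :
  q \in variety_ideal -> p * q \in variety_ideal.
Proof.
move=> /asboolP qT; apply/asboolP=> A A_ vA f [lf mf] gf.
by rewrite mf.2 (qT A A_) // mulr0.
Qed.

Fact variety_idealMr (p q : freeAlg) :
  q \in variety_ideal -> q * p \in variety_ideal.
Proof.
move=> /asboolP qT; apply/asboolP=> A A_ vA f [lf mf] gf.
by rewrite mf.2 (qT A A_) // mul0r.
Qed.

HB.instance Definition _ :=
  isTwoSided.Build freeAlg variety_ideal variety_idealMl variety_idealMr.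

Definition relFreeAlg := quotAlg variety_ideal.
HB.instance Definition _ := UnitalAlg.on relFreeAlg.
HB.instance Definition _ :=
  GRing.PzRing.copy relFreeAlg (UnitalAlg.sort relFreeAlg).

Definition rel_var (i : N) : relFreeAlg := cls variety_ideal (free_var i).

Definition rel_comp : G -> relFreeAlg -> Prop :=
  quot_comp (I := variety_ideal) free_comp.

Variable alpha : N -> N -> {fsfun N -> F with 0}.

Definition env_relation (x : relFreeAlg) : Prop :=
  exists i j : N, x = rel_var i * rel_var j - rel_var j * rel_var i
    - \sum_(k <- finsupp (alpha i j)) alpha i j k *: rel_var k.

Definition env_ideal : relFreeAlg -> bool := gen_ideal env_relation.
HB.instance Definition _ := TwoSidedIdeal.on env_ideal.

Definition envAlg := quotAlg env_ideal.
HB.instance Definition _ := UnitalAlg.on envAlg.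
HB.instance Definition _ :=
  GRing.PzRing.copy envAlg (UnitalAlg.sort envAlg).

Definition env_comp : G -> envAlg -> Prop :=
  quot_comp (I := env_ideal) rel_comp.

Definition env_var (i : N) : envAlg := cls env_ideal (rel_var i).

End FreeAlgebra.

Arguments rel_comp {F N G} d _ _.
Arguments env_relation {F N G} d alpha _.
Arguments env_ideal {F N G} d alpha _.
Arguments env_comp {F N G} d alpha _ _.

(* Main.v *)
Require Import Defs.
From HB Require Import structures.
From mathcomp Require Import all_boot all_algebra finmap boolp monalg.
Import GRing.Theory.
Local Open Scope ring_scope.

Set Implicit Arguments.
Unset Strict Implicit.
Unset Printing Implicit Defensive.

(** The strong pairs are exactly the pairs whose associative algebra lies in
    the variety.  If [gh <> hg], then [a b] and [b a] live in the distinct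
    components [A_gh] and [A_hg]; requiring [a b - b a] to stay in a single
    component kills both products ([strong_in_variety]), and conversely a
    commutator of homogeneous elements of an algebra of the variety is either
    zero or taken between components of commuting degrees
    ([in_variety_commutator]).

    Hence an enveloping algebra has to be found inside the variety, where free
    objects exist: the relatively free algebra modulo the relations of the Lie
    algebra.  For this quotient to be graded, the ideals must be homogeneous.
    The ideal of graded identities is homogeneous because graded maps commute
    with taking components ([variety_ideal_graded]).  The ideal of Lie
    relations is generated by homogeneous elements ([env_relation_homog]): the
    element [z_i z_j - z_j z_i] has degree [d_i d_j] by the remark on
    commutators, and so has the image of [[e_i, e_j]].  No discussion of
    whether [d_i] and [d_j] commute is left at this point; when they do not,
    both terms are simply zero.  Quotients by homogeneous ideals inherit the
    grading ([quot_graded_alg]) and the defining identities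
    ([quot_in_variety]).

    The universal property is then the usual one.  A strong pair over [H]
    together with a graded map from [L] gives elements of a given degree in an
    algebra of the variety, hence a map from the relatively free algebra
    ([relFree_lift]), which kills the Lie relations ([env_lift]); it is unique
    because the [z_i] generate ([env_hom_uniq]). *)

(** * Linear maps and bases *)

Section LinearMaps.
Variables (F : fieldType) (V W : lmodType F) (f : V -> W).
Hypothesis lf : linear f.

Let fL : {linear V -> W} := HB.pack f (GRing.isLinear.Build F V W *:%R f lf).

Lemma lin0 : f 0 = 0.
Proof. exact: (linear0 fL). Qed.

Lemma linB x y : f (x - y) = f x - f y.
Proof. exact: (linearB fL). Qed.

Lemma linZ c x : f (c *: x) = c *: f x.
Proof. exact: (linearZZ fL). Qed.

Lemma lin_sum (I : Type) (r : seq I) (P : pred I) (v : I -> V) :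
  f (\sum_(i <- r | P i) v i) = \sum_(i <- r | P i) f (v i).
Proof. exact: (linear_sum fL). Qed.

End LinearMaps.

Section Bases.
Variables (F : fieldType) (V : lmodType F) (N : choiceType) (e : N -> V).
Hypothesis basis_e : is_basis e.

(** Sums over the support of a family of coefficients are compared by moving
    them to a common larger index set. *)
Lemma lincomb_widen (W : lmodType F) (a : N -> W) (c : {fsfun N -> F with 0})
    (S : {fset N}) :
  {subset finsupp c <= S} ->
  \sum_(i <- finsupp c) c i *: a i = \sum_(i <- S) c i *: a i.
Proof.
move=> /fsubsetP cS; apply: big_fset_incl => // i _ ic.
by rewrite fsfun_dflt // scale0r.
Qed.

Definition coords (x : V) : {fsfun N -> F with 0} := sval (cid (basis_e x)).

Lemma coordsK x : x = \sum_(i <- finsupp (coords x)) coords x i *: e i.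
Proof. by rewrite /coords; case: (cid _) => c []. Qed.

Lemma coords_lincomb (c : {fsfun N -> F with 0}) x :
  x = \sum_(i <- finsupp c) c i *: e i -> coords x = c.
Proof. by rewrite /coords; case: (cid _) => c' /= [_]; apply. Qed.

Lemma coords_sum (S : {fset N}) (c : N -> F) i :
  coords (\sum_(i <- S) c i *: e i) i = if i \in S then c i else 0.
Proof.
rewrite (@coords_lincomb [fsfun i in S => c i | 0]) ?fsfunE //.
rewrite (@lincomb_widen _ _ _ S); last first.
  by move=> j; rewrite finsupp_fsfun !inE => /andP[].
by rewrite big_seq [RHS]big_seq; apply: eq_bigr => j jS; rewrite fsfunE jS.
Qed.

Lemma coords_linear i : linear (fun x => coords x i : F^o).
Proof.
move=> c x y; pose S := (finsupp (coords x) `|` finsupp (coords y))%fset.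
have eS z : {subset finsupp (coords z) <= S} ->
    z = \sum_(j <- S) coords z j *: e j.
  by move=> zS; rewrite {1}(coordsK z) (lincomb_widen _ zS).
have xS : {subset finsupp (coords x) <= S} by apply/fsubsetP/fsubsetUl.
have yS : {subset finsupp (coords y) <= S} by apply/fsubsetP/fsubsetUr.
have -> : c *: x + y
    = \sum_(j <- S) (c * coords x j + coords y j) *: e j.
  rewrite {1}(eS _ xS) {1}(eS _ yS) scaler_sumr -big_split; apply: eq_bigr => j _.
  by rewrite /= scalerA -scalerDl.
rewrite coords_sum; case: ifP => // /negbT iS.
by rewrite !fsfun_dflt ?scaler0 ?addr0 //; apply: contra iS; [exact: yS|exact: xS].
Qed.

Lemma coords0 i : coords 0 i = 0.
Proof. exact: (lin0 (coords_linear i)). Qed.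

Lemma coords_basis i j : coords (e i) j = (i == j)%:R.
Proof.
have := coords_sum [fset i]%fset (fun=> 1) j.
by rewrite big_seq_fset1 scale1r inE eq_sym => ->; case: eqP.
Qed.

Lemma coords_inj x y : (forall i, coords x i = coords y i) -> x = y.
Proof. by move=> /fsfunP xy; rewrite (coordsK x) xy -coordsK. Qed.

Section Extension.
Variables (W : lmodType F) (a : N -> W).

Definition lin_ext (x : V) : W :=
  \sum_(i <- finsupp (coords x)) coords x i *: a i.

Lemma lin_ext_linear : linear lin_ext.
Proof.
move=> c x y; pose S := (finsupp (coords x) `|` finsupp (coords y)
  `|` finsupp (coords (c *: x + y)))%fset.
have eS z : {subset finsupp (coords z) <= S} ->
    lin_ext z = \sum_(j <- S) coords z j *: a j by apply: lincomb_widen.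
rewrite (eS x) => [|j jz]; last by rewrite !inE jz.
rewrite (eS y) => [|j jz]; last by rewrite !inE jz orbT.
rewrite eS => [|j jz]; last by rewrite !inE jz !orbT.
rewrite scaler_sumr -big_split /=.
by apply: eq_bigr => j _; rewrite coords_linear scalerDl scalerA.
Qed.

Lemma lin_ext_basis i : lin_ext (e i) = a i.
Proof.
rewrite /lin_ext (@lincomb_widen _ _ _ [fset i]%fset).
  by rewrite big_seq_fset1 coords_basis eqxx scale1r.
move=> j; rewrite mem_finsupp coords_basis inE [i == j]eq_sym.
by case: (j == i) => //; rewrite eqxx.
Qed.

End Extension.

Lemma lin_extE (W : lmodType F) (f : V -> W) :
  linear f -> f =1 lin_ext (f \o e).
Proof.
move=> lf x; rewrite {1}(coordsK x) lin_sum //.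
by apply: eq_bigr => i _; rewrite linZ.
Qed.

Lemma eq_linear_basis (W : lmodType F) (f f' : V -> W) :
  linear f -> linear f' -> (forall i, f (e i) = f' (e i)) -> f =1 f'.
Proof.
move=> lf lf' ff' x; rewrite (lin_extE lf) (lin_extE lf').
by apply: eq_bigr => i _; rewrite /= ff'.
Qed.

(** Reduces multiplicativity of the evaluation of polynomials, and
    compatibility with brackets, to monomials and basis vectors. *)
Lemma eq_bilinear_basis (W : lmodType F) (b b' : V -> V -> W) :
  (forall y, linear (b^~ y)) -> (forall x, linear (b x)) ->
  (forall y, linear (b'^~ y)) -> (forall x, linear (b' x)) ->
  (forall i j, b (e i) (e j) = b' (e i) (e j)) ->
  forall x y, b x y = b' x y.
Proof.
move=> bl br bl' br' bb' x y.
apply: (eq_linear_basis (bl y) (bl' y)) => i.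
exact: (eq_linear_basis (br (e i)) (br' (e i))).
Qed.

End Bases.

(** * Gradings and homogeneous components *)

Section GradedSpaces.
Variables (G : groupType) (F : fieldType).
Implicit Types (V W : lmodType F).

Section Closure.
Variables (V : lmodType F) (V_ : G -> V -> Prop).
Hypothesis gV : is_grading V_.

Lemma gradingD g x y : V_ g x -> V_ g y -> V_ g (x + y).
Proof. by move=> xg yg; rewrite -[x]scale1r; apply: gradingP. Qed.

Lemma gradingZ g c x : V_ g x -> V_ g (c *: x).
Proof.
by move=> xg; rewrite -[_ *: _]addr0; apply: gradingP => //; apply: grading0.
Qed.

Lemma gradingB g x y : V_ g x -> V_ g y -> V_ g (x - y).
Proof. by move=> xg yg; rewrite -scaleN1r addrC; apply: gradingP. Qed.

Lemma grading_sum g (I : eqType) (r : seq I) (v : I -> V) :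
  {in r, forall i, V_ g (v i)} -> V_ g (\sum_(i <- r) v i).
Proof.
move=> vg; rewrite big_seq; elim/big_ind: _ => //; first exact: grading0.
by move=> x y; apply: gradingD.
Qed.

Definition component (g : G) (x : V) : V := sval (cid (grading_dec gV x)) g.

Lemma component_in g x : V_ g (component g x).
Proof. by rewrite /component; case: (cid _) => f [[]]. Qed.

Lemma component_sum x :
  exists S : {fset G}, x = \sum_(g <- S) component g x.
Proof.
exists (finsupp (sval (cid (grading_dec gV x)))).
by rewrite /component; case: (cid _) => f [[]].
Qed.

(** Any homogeneous decomposition is the canonical one: this is where the
    directness of the sum enters, and all other properties of components follow
    from it. *)
Lemma component_uniq (S : {fset G}) (v : G -> V) g :
  (forall h, V_ h (v h)) ->
  component g (\sum_(h <- S) v h) = if g \in S then v g else 0.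
Proof.
move=> vh; pose f : {fsfun G -> V with 0} := [fsfun h in S => v h | 0].
rewrite /component; case: (cid _) => f' /= [_ /(_ f) ->].
  by rewrite fsfunE.
split=> [h|].
  by rewrite fsfunE; case: ifP => // _; apply: grading0.
have sfS : (finsupp f `<=` S)%fset.
  by apply/fsubsetP => j; rewrite finsupp_fsfun !inE => /andP[].
rewrite (big_fset_incl _ sfS); last by move=> h _ /fsfun_dflt.
by rewrite big_seq [RHS]big_seq; apply: eq_bigr => h hS; rewrite fsfunE hS.
Qed.

Lemma component_homog g h x :
  V_ h x -> component g x = if g == h then x else 0.
Proof.
move=> xh; have -> : x = \sum_(k <- [fset h]%fset) if k == h then x else 0.
  by rewrite big_seq_fset1 eqxx.
rewrite component_uniq ?inE => [|k]; first by rewrite big_seq_fset1 eqxx; case: eqP.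
by case: eqP => [->|_]; last exact: grading0.
Qed.

Lemma component_linear g : linear (component g).
Proof.
move=> c x y; have [S xS] := component_sum x; have [T yT] := component_sum y.
pose U := (S `|` T)%fset.
have widen z (Z : {fset G}) : z = \sum_(h <- Z) component h z ->
    {subset Z <= U} -> z = \sum_(h <- U) component h z.
  move=> zZ /fsubsetP ZU; rewrite {1}zZ; apply: big_fset_incl => // h _ hZ.
  by rewrite zZ component_uniq ?(negPf hZ) // => k; apply: component_in.
have xU := widen x S xS (fsubsetP (fsubsetUl _ _)).
have yU := widen y T yT (fsubsetP (fsubsetUr _ _)).
have out z : z = \sum_(h <- U) component h z -> g \notin U -> component g z = 0.
  by move=> -> gU; rewrite component_uniq ?(negPf gU) // => k; apply: component_in.
rewrite {1}xU {1}yU scaler_sumr -big_split component_uniq /=.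
  case: ifP => // /negbT gU.
  by rewrite (out x) // (out y) // scaler0 addr0.
by move=> h; apply: gradingP => //; apply: component_in.
Qed.

Lemma homog_disjoint g h x : V_ g x -> V_ h x -> g <> h -> x = 0.
Proof.
move=> xg xh /eqP/negPf gh; have := component_homog h xg.
by rewrite (component_homog h xh) eqxx eq_sym gh.
Qed.

End Closure.

(** A grading is conveniently built from its projections: applying [P g] to any
    homogeneous decomposition extracts the term of degree [g], whence
    uniqueness.  Both gradings constructed below (on a space with a graded
    basis, on a quotient) come with obvious projections. *)
Lemma is_grading_proj V (V_ : G -> V -> Prop) (P : G -> V -> V) :
  (forall g, V_ g 0) ->
  (forall g c x y, V_ g x -> V_ g y -> V_ g (c *: x + y)) ->
  (forall g, linear (P g)) -> (forall g x, V_ g (P g x)) ->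
  (forall g h x, V_ h x -> P g x = if g == h then x else 0) ->
  (forall x, exists S : {fset G}, x = \sum_(g <- S) P g x) ->
  is_grading V_.
Proof.
move=> V0 VP Plin Pin Phom Psum; split=> // x.
have [S xS] := Psum x.
have coef (T : {fset G}) (v : G -> V) g : (forall h, V_ h (v h)) ->
    P g (\sum_(h <- T) v h) = if g \in T then v g else 0.
  move=> vh; rewrite lin_sum //; under eq_bigr do rewrite (Phom _ _ _ (vh _)).
  case: ifPn => gT; last first.
    by rewrite big_seq big1 // => h hT; case: eqP => // gh; rewrite gh hT in gT.
  rewrite (big_fsetD1 g) //= eqxx big1_fset ?addr0 // => h; rewrite !inE eq_sym.
  by case/andP=> /negPf ->.
exists [fsfun g in S => P g x | 0]; split=> [|f [fh xf]].
  split=> [g|]; first by rewrite fsfunE; case: ifP.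
  rewrite {1}xS; apply: esym.
  rewrite (_ : \sum_(g <- S) P g x
    = \sum_(g <- S) [fsfun g in S => P g x | 0] g); last first.
    by rewrite big_seq [RHS]big_seq; apply: eq_bigr => h hS; rewrite fsfunE hS.
  apply: big_fset_incl; last by move=> h _ /fsfun_dflt.
  by apply/fsubsetP => j; rewrite finsupp_fsfun !inE => /andP[].
apply/fsfunP => g; rewrite fsfunE.
have <- : P g x = f g.
  by rewrite {1}xf coef //; case: ifPn => // /fsfun_dflt.
by case: ifPn => // gS; rewrite xS coef // (negPf gS).
Qed.

(** A linear map that moves degrees by an injection moves the components
    accordingly; the injection is the identity for graded maps, and a
    translation of the group for multiplication by a homogeneous element. *)
Lemma component_shift V W (V_ : G -> V -> Prop) (W_ : G -> W -> Prop)
    (gV : is_grading V_) (gW : is_grading W_) (s : G -> G) (f : V -> W) :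
  injective s -> linear f -> (forall g x, V_ g x -> W_ (s g) (f x)) ->
  forall g x, component gW (s g) (f x) = f (component gV g x).
Proof.
move=> s_inj lf fs g x; have [S xS] := component_sum gV x.
have xin k : V_ k (component gV k x) by apply: component_in.
rewrite {1 2}xS (component_uniq gV) // (lin_sum lf).
rewrite (lin_sum (component_linear gW _)).
under eq_bigr => k _ do
  rewrite (component_homog gW _ (fs _ _ (xin k))) (inj_eq s_inj).
case: ifPn => gS; last first.
  rewrite (lin0 lf) big_seq big1 // => k kS; case: eqP => // gk.
  by rewrite gk kS in gS.
rewrite (big_fsetD1 g) //= eqxx big1_fset ?addr0 // => k.
by rewrite !inE eq_sym => /andP[/negPf ->].
Qed.

Section HomogeneousBasis.
Variables (V : lmodType F) (N : choiceType) (e : N -> V) (d : N -> G).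
Hypothesis basis_e : is_basis e.

Definition span_comp (g : G) (x : V) : Prop :=
  forall i, coords basis_e x i != 0 -> d i = g.

(** The projection onto degree [g] keeps the basis vectors of degree [g] and
    kills the others; it acts on coordinates in the same way. *)
Lemma span_grading : is_grading span_comp.
Proof.
pose P g := lin_ext basis_e (fun i => if d i == g then e i else 0).
have Plin g : linear (P g) by apply: lin_ext_linear.
have coefP g x i : coords basis_e (P g x) i
    = if d i == g then coords basis_e x i else 0.
  (* both sides are linear in [x], so basis vectors suffice *)
  pose q x : F^o := coords basis_e (P g x) i.
  pose q' x : F^o := if d i == g then coords basis_e x i else 0.
  have ql : linear q by move=> c y z; rewrite /q Plin coords_linear.
  have ql' : linear q'.
    move=> c y z; rewrite /q'; case: ifP => _; rewrite ?coords_linear //.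
    by rewrite scaler0 addr0.
  apply: (eq_linear_basis basis_e ql ql') => j; rewrite /q /q' /P lin_ext_basis.
  case: (boolP (d j == g)) => [jg|/negPf jg]; rewrite coords_basis.
    by case: (j =P i) => [<-|_]; rewrite ?jg //; case: ifP.
  rewrite coords0.
  by case: (j =P i) => [<-|_]; rewrite ?jg //; case: ifP.
apply: (@is_grading_proj _ _ P) => //.
- by move=> g i; rewrite coords0 eqxx.
- move=> g c x y xg yg i; rewrite (coords_linear basis_e i) => nz.
  have [x0|/xg //] := eqVneq (coords basis_e x i) 0.
  by apply: yg; apply: contraNneq nz => ->; rewrite x0 scaler0 addr0.
- by move=> g x i; rewrite coefP; case: (d i =P g) => // _; rewrite eqxx.
- move=> g h x xh; apply: (@coords_inj _ _ _ _ basis_e) => i; rewrite coefP.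
  have [xi0|/xh ->] := eqVneq (coords basis_e x i) 0.
    rewrite xi0 if_same; case: ifP => // _.
    by rewrite coords0.
  rewrite eq_sym; case: ifP => // _.
  by rewrite coords0.
(* only the degrees of basis vectors occurring in [x] contribute *)
- move=> x; pose S := [fset d i | i in finsupp (coords basis_e x)]%fset.
  exists S; apply: (@coords_inj _ _ _ _ basis_e) => i.
  rewrite (lin_sum (coords_linear basis_e i)) /=.
  under eq_bigr do rewrite coefP.
  have [/fsfun_dflt xi|ix] := boolP (i \notin finsupp (coords basis_e x)).
    by rewrite xi big1 // => g _; rewrite if_same.
  have dS : d i \in S by apply/imfsetP; exists i; rewrite ?(negbNE ix).
  rewrite (big_fsetD1 (d i)) //= eqxx big1_fset ?addr0 // => g.
  by rewrite !inE eq_sym => /andP[/negPf ->].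
Qed.

End HomogeneousBasis.
End GradedSpaces.

Section GradedBasis.
Variables (G : groupType) (F : fieldType) (V : lmodType F).
Variables (V_ : G -> V -> Prop) (N : choiceType) (e : N -> V) (d : N -> G).
Hypotheses (gV : is_grading V_) (basis_e : is_basis e)
  (ed : forall i, V_ (d i) (e i)).

(** Projecting the expansion of a homogeneous [x] onto its own degree removes
    the basis vectors of other degrees without changing [x]; coordinates being
    unique, those basis vectors did not occur. *)
Lemma coords_homog g x i : V_ g x -> coords basis_e x i != 0 -> d i = g.
Proof.
move=> xg; apply: contra_neqP => /eqP/negPf dg.
have := component_homog gV g xg; rewrite eqxx => <-.
rewrite {1}(coordsK basis_e x) (lin_sum (component_linear gV g)).
under eq_bigr => j _ do
  rewrite (linZ (component_linear gV g)) (component_homog gV g (ed j)) eq_sym.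
rewrite (_ : \sum_(_ <- _) _ = \sum_(j <- finsupp (coords basis_e x))
  (if d j == g then coords basis_e x j else 0) *: e j).
  by rewrite coords_sum dg if_same.
by apply: eq_bigr => j _; case: ifP; rewrite ?scaler0 ?scale0r.
Qed.

Lemma lin_ext_graded (W : lmodType F) (W_ : G -> W -> Prop) (a : N -> W) :
  is_grading W_ -> (forall i, W_ (d i) (a i)) ->
  graded_map V_ W_ (lin_ext basis_e a).
Proof.
move=> gW ad g x xg; apply: (grading_sum gW) => i.
by rewrite mem_finsupp => /(coords_homog xg) <-; apply: gradingZ.
Qed.

End GradedBasis.

(** * Graded algebras, the variety and strong pairs *)

Section Bilinearity.
Variables (F : fieldType) (V : lmodType F) (A : unitalAlgType F).

Lemma id_linear : linear (@id V).
Proof. by []. Qed.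

Lemma mul_linearl (f : V -> A) a : linear f -> linear (fun x => f x * a).
Proof. by move=> lf c x y; rewrite lf mulrDl unitalAlg_scaleAl. Qed.

Lemma mul_linearr (f : V -> A) a : linear f -> linear (fun x => a * f x).
Proof. by move=> lf c x y; rewrite lf mulrDr unitalAlg_scaleAr. Qed.

End Bilinearity.

Lemma lie_morph_basis (F : fieldType) (L : lieAlgType F) (A : unitalAlgType F)
    (N : choiceType) (e : N -> L) (f : L -> A) :
  is_basis e -> linear f ->
  (forall i j, f (lie (e i) (e j)) = commutator (f (e i)) (f (e j))) ->
  {morph f : x y / lie x y >-> commutator x y}.
Proof.
move=> basis_e lf fe; apply: (eq_bilinear_basis basis_e) => //.
- by move=> y c x z; rewrite lie_linearl lf.
- by move=> x c y z; rewrite lie_linearr lf.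
- move=> y c x z; rewrite /commutator (mul_linearl _ lf) (mul_linearr _ lf).
  by rewrite scalerBr opprD addrACA.
- move=> y c x z; rewrite /commutator (mul_linearl _ lf) (mul_linearr _ lf).
  by rewrite scalerBr opprD addrACA.
Qed.

Section GradedAlgebras.
Variables (G : groupType) (F : fieldType) (A : unitalAlgType F).
Variable A_ : G -> A -> Prop.

Section Components.
Hypotheses (gA : is_grading A_)
  (mulA_ : forall g h a b, A_ g a -> A_ h b -> A_ (g * h)%g (a * b)).

Lemma component_mulr g h a x :
  A_ h x -> component gA (g * h)%g (a * x) = component gA g a * x.
Proof.
move=> xh.
apply: (component_shift gA gA (mulIg h) (mul_linearl x (@id_linear F A))).
by move=> k y yk; apply: mulA_.
Qed.

Lemma component_mull g h a x :
  A_ h x -> component gA (h * g)%g (x * a) = x * component gA g a.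
Proof.
move=> xh.
apply: (component_shift gA gA (mulgI h) (mul_linearr x (@id_linear F A))).
by move=> k y yk; apply: mulA_.
Qed.

End Components.

(** The component [u] of degree [1] of the unit acts as a left identity on
    homogeneous elements [x], as both [u * x] and [x = 1 * x] are the component
    of [1 * x] in the degree of [x].  So [u] is a left identity, hence the unit.
    Cancellation in the grading group is essential. *)
Lemma graded_alg1 : graded_alg A_ -> A_ 1%g 1.
Proof.
case=> gA mulA_; pose u := component gA 1%g 1.
have uK h x : A_ h x -> u * x = x.
  move=> xh; rewrite -(component_mulr gA mulA_ _ _ xh) mul1g mul1r.
  by rewrite (component_homog gA _ xh) eqxx.
have [S oneS] := component_sum gA 1.
suff <- : u = 1 by apply: component_in.
rewrite -[LHS]mulr1 [X in _ * X = _]oneS mulr_sumr [RHS]oneS.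
by apply: eq_bigr => g _; apply: (uK g); apply: component_in.
Qed.

(** Either the degrees commute, and both products have degree [g h], or both
    products vanish. *)
Lemma in_variety_commutator : in_variety A_ ->
  forall g h a b, A_ g a -> A_ h b -> A_ (g * h)%g (commutator a b).
Proof.
move=> [[gA mulA_] vA] g h a b ag bh; rewrite /commutator.
have [gh|/eqP gh] := eqVneq [~ g, h]%g 1%g.
  apply: gradingB => //; first exact: mulA_.
  by move/eqP/commgP: gh => ->; apply: mulA_.
have hg : [~ h, g]%g <> 1%g.
  by move=> hg1; apply: gh; rewrite -invgR hg1 invg1.
by rewrite (vA _ _ gh) // (vA _ _ hg) // subr0; apply: grading0.
Qed.

(** The product [a b = b a - (b a - a b)] has degree [h g] as well as [g h], so
    it is zero unless the two agree. *)
Lemma strong_in_variety : graded_alg A_ ->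
  (forall g h a b, A_ g a -> A_ h b -> A_ (g * h)%g (commutator a b)) ->
  in_variety A_.
Proof.
move=> gA strong; split=> // g h gh a b ag bh; case: gA => gA mulA_.
apply: (homog_disjoint gA (mulA_ _ _ _ _ ag bh) (h := (h * g)%g)).
  have -> : a * b = b * a - commutator b a by rewrite /commutator opprB addrC subrK.
  by apply: gradingB => //; [apply: mulA_ | apply: strong].
by move=> ghC; apply: gh; apply/eqP/commgP.
Qed.

End GradedAlgebras.

Section AlgHoms.
Variables (F : fieldType) (A B C : unitalAlgType F).

Lemma alg_hom_comp (f : B -> C) (g : A -> B) :
  alg_hom f -> alg_hom g -> alg_hom (f \o g).
Proof.
move=> [lf [f1 fM]] [lg [g1 gM]]; split; last split=> [|x y] /=.
- by move=> c x y /=; rewrite lg lf.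
- by rewrite g1.
- by rewrite gM fM.
Qed.

End AlgHoms.

(** * Ideals and quotients *)

Section Quotients.
Variables (F : fieldType) (A B : unitalAlgType F).

Lemma cls_hom (I : idealType A) : alg_hom (cls I).
Proof.
split; last by split=> // x y; apply: esym; apply: (cls_mul I).
by move=> c x y; rewrite clsD -cls_scale.
Qed.

Lemma cls0 (I : idealType A) x : x \in I -> cls I x = 0.
Proof.
by move=> xI; rewrite -(lin0 (cls_hom I).1); apply/cls_eqP; rewrite subr0.
Qed.

Lemma quot_lift (I : idealType A) (f : A -> B) :
  alg_hom f -> (forall x, x \in I -> f x = 0) ->
  exists2 fI : quotAlg I -> B, alg_hom fI & forall x, fI (cls I x) = f x.
Proof.
move=> [lf [f1 fM]] fI.
have fK x : f (repr (cls I x)) = f x.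
  by apply/eqP; rewrite -subr_eq0 -linB //; apply/eqP/fI/cls_repr.
exists (fun q => f (repr q)) => //.
have [lc [c1 cM]] := cls_hom I.
split; last split.
- move=> c p q; have [x ->] := cls_surj p; have [y ->] := cls_surj q.
  by rewrite -lc !fK lf.
- by rewrite -c1 fK f1.
- move=> p q; have [x ->] := cls_surj p; have [y ->] := cls_surj q.
  by rewrite -cM !fK fM.
Qed.

Lemma gen_ideal_incl (S : A -> Prop) (x : A) : S x -> x \in gen_ideal S.
Proof. by move=> Sx; apply/asboolP => I; apply. Qed.

(** The kernel of an algebra morphism is a two-sided ideal. *)
Lemma gen_ideal_ker (S : A -> Prop) (f : A -> B) :
  alg_hom f -> (forall x, S x -> f x = 0) ->
  forall x, x \in gen_ideal S -> f x = 0.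
Proof.
move=> [lf [f1 fM]] fS x.
pose K : A -> bool := fun x => f x == 0.
have Kz : zmod_closed K.
  split=> [|a b /eqP a0 /eqP b0]; apply/eqP; first by rewrite lin0.
  by rewrite linB // a0 b0 subr0.
have Kl a y : y \in K -> a * y \in K.
  by move=> /eqP y0; apply/eqP; rewrite fM y0 mulr0.
have Kr a y : y \in K -> y * a \in K.
  by move=> /eqP y0; apply/eqP; rewrite fM y0 mul0r.
pose KI : idealType A := HB.pack K (GRing.isZmodClosed.Build A K Kz)
  (isTwoSided.Build A K Kl Kr).
move=> /asboolP /(_ KI) xK; apply/eqP; apply: xK => s /fS s0.
exact/eqP.
Qed.

End Quotients.

Section GradedQuotients.
Variables (G : groupType) (F : fieldType) (A : unitalAlgType F).
Variable A_ : G -> A -> Prop.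

Definition graded_ideal (gA : is_grading A_) (I : A -> bool) : Prop :=
  forall g x, x \in I -> component gA g x \in I.

(** The elements all of whose components lie in the generated ideal [J] form a
    two-sided ideal [K], since multiplying by a homogeneous element permutes
    components; [K] contains the generators, which are their own only nonzero
    component. *)
Lemma gen_ideal_graded (gA : is_grading A_) (S : A -> Prop) :
  (forall g h a b, A_ g a -> A_ h b -> A_ (g * h)%g (a * b)) ->
  (forall x, S x -> exists g, A_ g x) -> graded_ideal gA (gen_ideal S).
Proof.
move=> mulA_ Shom g x xS; move: x xS g.
pose J : idealType A := gen_ideal S.
pose K : A -> bool := fun x => `[< forall g, component gA g x \in J >].
have clin g := component_linear gA g.
have Kz : zmod_closed K.
  split=> [|a b /asboolP a0 /asboolP b0]; apply/asboolP => g.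
    by rewrite (lin0 (clin g)) rpred0.
  by rewrite (linB (clin g)) rpredB.
have Kl a y : y \in K -> a * y \in K.
  move=> /asboolP yK; apply/asboolP => g.
  have [T ->] := component_sum gA a; rewrite mulr_suml (lin_sum (clin g)).
  apply: rpred_sum => h _; rewrite -[g](mulVKg h).
  by rewrite component_mull //; [apply: idealMl | apply: component_in].
have Kr a y : y \in K -> y * a \in K.
  move=> /asboolP yK; apply/asboolP => g.
  have [T ->] := component_sum gA a; rewrite mulr_sumr (lin_sum (clin g)).
  apply: rpred_sum => h _; rewrite -[g](mulgVK h).
  by rewrite component_mulr //; [apply: Defs.idealMr | apply: component_in].
pose KI : idealType A := HB.pack K (GRing.isZmodClosed.Build A K Kz)
  (isTwoSided.Build A K Kl Kr).
move=> x /asboolP /(_ KI) xK; apply/asboolP; apply: xK => s Ss.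
apply/asboolP => g; have [h sh] := Shom s Ss.
rewrite (component_homog gA _ sh); case: eqP => _; last exact: rpred0.
exact: gen_ideal_incl.
Qed.

Variable I : idealType A.

(** Homogeneity of [I] says precisely that the projections of [A] descend to
    the quotient. *)
Lemma quot_graded_alg (gA : is_grading A_) :
  (forall g h a b, A_ g a -> A_ h b -> A_ (g * h)%g (a * b)) ->
  graded_ideal gA I -> graded_alg (quot_comp (I := I) A_).
Proof.
move=> mulA_ hI.
have [lc [c1 cM]] := cls_hom I.
pose P g (q : quotAlg I) : quotAlg I := cls I (component gA g (repr q)).
have PK g x : P g (cls I x) = cls I (component gA g x).
  apply/cls_eqP; rewrite -(linB (component_linear gA g)).
  exact/hI/cls_repr.
split; last first.
  move=> g h _ _ [x xg ->] [y yh ->]; exists (x * y); last by rewrite cM.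
  exact: mulA_.
apply: (@is_grading_proj _ _ _ _ P).
- by move=> g; exists 0; [exact: grading0 | rewrite lin0].
- move=> g c _ _ [x xg ->] [y yg ->]; exists (c *: x + y); last by rewrite lc.
  exact: gradingP.
- move=> g c p q; have [x ->] := cls_surj p; have [y ->] := cls_surj q.
  by rewrite -lc !PK (component_linear gA g) lc.
- by move=> g q; exists (component gA g (repr q)); first exact: component_in.
- move=> g h _ [x xh ->]; rewrite PK (component_homog gA _ xh).
  by case: ifP => // _; rewrite lin0.
- move=> q; have [x ->] := cls_surj q; have [S xS] := component_sum gA x.
  exists S; under eq_bigr do rewrite PK.
  by rewrite -(lin_sum lc) -xS.
Qed.

Lemma quot_in_variety : graded_alg (quot_comp (I := I) A_) ->
  (forall g h, [~ g, h]%g <> 1%g ->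
    forall a b, A_ g a -> A_ h b -> a * b \in I) ->
  in_variety (quot_comp (I := I) A_).
Proof.
move=> gQ vI; split=> // g h gh _ _ [x xg ->] [y yh ->].
by rewrite -(cls_hom I).2.2; apply: cls0; apply: vI gh _ _ xg yh.
Qed.

End GradedQuotients.

(** * The free algebra *)

Section FreeAlgebra.
Variables (F : fieldType) (N : choiceType).

Definition monomial (m : {fmonom N}) : freeAlg F N := << m >>.

Lemma monomial_sum (c : {fsfun {fmonom N} -> F with 0}) :
  \sum_(m <- finsupp c) c m *: monomial m = mkmalg c.
Proof.
rewrite [RHS]monalgE; apply: eq_bigr => m _; apply/malgP => k.
by rewrite /monomial mcoeffZ !mcoeffU mulrnAr mulr1.
Qed.

(** With words as a basis, evaluation morphisms and the grading by word degree
    are instances of the constructions for spaces with a basis. *)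
Lemma monomial_basis : is_basis monomial.
Proof.
move=> p; exists (malg_val p); split=> [|c ->]; last by rewrite monomial_sum.
by rewrite monomial_sum; apply: val_inj.
Qed.

Lemma coords_monomial (p : freeAlg F N) m : coords monomial_basis p m = p@_m.
Proof.
rewrite (_ : coords _ p = malg_val p) //; apply: coords_lincomb.
by rewrite monomial_sum; apply: val_inj.
Qed.

Lemma monomialM m1 m2 :
  monomial m1 * monomial m2 = monomial (mmul m1 m2).
Proof.
apply: (etrans (fgmulUU _ _ _ _)); by rewrite mulr1.
Qed.

Lemma monomial_cons i (s : seq N) :
  monomial (FMonom (i :: s)) = free_var F i * monomial (FMonom s).
Proof.
rewrite [RHS]monomialM; congr (monomial _).
by apply: val_inj; rewrite /= fmM fmU.
Qed.

Section Evaluation.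
Variables (A : unitalAlgType F) (a : N -> A).

Definition word_eval (m : {fmonom N}) : A := \prod_(i <- (m : seq N)) a i.

Definition free_eval : freeAlg F N -> A := lin_ext monomial_basis word_eval.

Lemma free_eval_hom : alg_hom free_eval.
Proof.
have lf : linear free_eval by apply: lin_ext_linear.
have fmon m : free_eval (monomial m) = word_eval m by apply: lin_ext_basis.
split=> //; split.
  rewrite [X in free_eval X](_ : 1 = monomial mone) // fmon /word_eval.
  by rewrite fm1 big_nil.
apply: (eq_bilinear_basis monomial_basis).
- by move=> q c x y; rewrite -lf; congr free_eval; apply: free_mul_linearl.
- by move=> p c x y; rewrite -lf; congr free_eval; apply: free_mul_linearr.
- by move=> q; apply: mul_linearl.
- by move=> p; apply: mul_linearr.
by move=> m1 m2; rewrite monomialM !fmon /word_eval fmM big_cat.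
Qed.

Lemma free_eval_var i : free_eval (free_var F i) = a i.
Proof.
by rewrite [LHS]lin_ext_basis /word_eval fmU big_seq1.
Qed.

End Evaluation.

Lemma free_hom_uniq (A : unitalAlgType F) (f f' : freeAlg F N -> A) :
  alg_hom f -> alg_hom f' ->
  (forall i, f (free_var F i) = f' (free_var F i)) -> f =1 f'.
Proof.
move=> [lf [f1 fM]] [lf' [f1' fM']] ff'.
apply: (eq_linear_basis monomial_basis lf lf') => -[s].
elim: s => [|i s IH].
  rewrite (_ : monomial (FMonom [::]) = 1) ?f1 ?f1' //.
  by congr (monomial _); apply: val_inj; rewrite /= fm1.
by rewrite monomial_cons fM fM' ff' IH.
Qed.

Variables (G : groupType) (d : N -> G).

Lemma free_graded : is_grading (free_comp (F := F) d).
Proof.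
suff -> : free_comp (F := F) d = span_comp (word_degree d) monomial_basis.
  exact: span_grading.
apply/funext => g; apply/funext => p; apply/propext.
by split=> pg m; move: (pg m); rewrite coords_monomial mcoeff_neq0.
Qed.

Lemma word_degreeM m1 m2 :
  word_degree d (mmul m1 m2) = (word_degree d m1 * word_degree d m2)%g.
Proof. by rewrite /word_degree fmM big_cat. Qed.

Lemma free_compM g h (p q : freeAlg F N) :
  free_comp d g p -> free_comp d h q -> free_comp d (g * h)%g (p * q).
Proof.
move=> pg qh m /msuppM_le [m1 [m2 [m1p m2q ->]]].
by rewrite word_degreeM (pg _ m1p) (qh _ m2q).
Qed.

Lemma free_comp_var i : free_comp (F := F) d (d i) (free_var F i).
Proof.
move=> m; rewrite msuppU1 inE => /eqP ->.
by rewrite /word_degree fmU big_seq1.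
Qed.

Lemma free_eval_graded (A : unitalAlgType F) (A_ : G -> A -> Prop)
    (a : N -> A) :
  graded_alg A_ -> (forall i, A_ (d i) (a i)) ->
  graded_map (free_comp d) A_ (free_eval a).
Proof.
move=> gA ad g p pg; rewrite /free_eval /lin_ext.
have wA m : A_ (word_degree d m) (word_eval a m).
  rewrite /word_degree /word_eval.
  elim: (m : seq N) => [|i s IH]; first by rewrite !big_nil; apply: graded_alg1.
  by rewrite !big_cons; apply: gA.2.
apply: grading_sum gA.1 _ _ _ _ _ => m.
rewrite mem_finsupp coords_monomial mcoeff_neq0 => /pg <-.
by apply: (gradingZ gA.1).
Qed.

(** * The relatively free algebra *)

(** A graded morphism that kills [p] kills each of its components, because they
    are sent to the components of [0]. *)
Lemma variety_ideal_graded : graded_ideal free_graded (variety_ideal (F := F) d).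
Proof.
move=> g p /asboolP pT; apply/asboolP => A A_ vA f hf gf.
rewrite -(component_shift _ vA.1.1 (@inj_id G) hf.1 gf) (pT A A_) //.
exact: (lin0 (component_linear _ _)).
Qed.

(** The products that have to vanish in the quotient are graded identities. *)
Lemma relFree_in_variety : in_variety (rel_comp (F := F) d).
Proof.
apply: quot_in_variety.
  exact: (quot_graded_alg free_compM variety_ideal_graded).
move=> g h gh p q pg qh; apply/asboolP => A A_ vA f hf gf.
by rewrite hf.2.2 (vA.2 _ _ gh) //; apply: gf.
Qed.

Lemma rel_comp_var i : rel_comp (F := F) d (d i) (rel_var F d i).
Proof. by exists (free_var F i) => //; apply: free_comp_var. Qed.

Lemma relFree_lift (A : unitalAlgType F) (A_ : G -> A -> Prop) (a : N -> A) :
  in_variety A_ -> (forall i, A_ (d i) (a i)) ->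
  exists f : relFreeAlg F d -> A,
    [/\ alg_hom f, graded_map (rel_comp d) A_ f
      & forall i, f (rel_var F d i) = a i].
Proof.
move=> vA ad; have hf := free_eval_hom a.
have gf := free_eval_graded vA.1 ad.
have [f hfI fK] : exists2 f : relFreeAlg F d -> A, alg_hom f &
    forall x, f (cls (variety_ideal d) x) = free_eval a x.
  apply: quot_lift => // p /asboolP pT; exact: pT vA _ hf gf.
exists f; split=> // [g _ [p pg ->]|i]; first by rewrite fK; apply: gf.
by rewrite fK free_eval_var.
Qed.

End FreeAlgebra.

(** * The enveloping algebra *)

Section Enveloping.
Variables (G : groupType) (F : fieldType) (L : lieAlgType F).
Variables (L_ : G -> L -> Prop) (N : choiceType) (e : N -> L) (d : N -> G).
Variable alpha : N -> N -> {fsfun N -> F with 0}.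
Hypotheses (gL : graded_lie L_) (basis_e : is_basis e)
  (ed : forall i, L_ (d i) (e i))
  (alphaE : forall i j,
     lie (e i) (e j) = \sum_(k <- finsupp (alpha i j)) alpha i j k *: e k).

Notation U := (envAlg d alpha).

Definition env_iota : L -> U := lin_ext basis_e (env_var d alpha).

(** Reads the linear part of the Lie relations as the image of a bracket, whose
    degree is known from the grading of [L], with no case analysis on the
    structure constants. *)
Lemma lin_ext_lie (W : lmodType F) (a : N -> W) i j :
  lin_ext basis_e a (lie (e i) (e j))
    = \sum_(k <- finsupp (alpha i j)) alpha i j k *: a k.
Proof. by rewrite /lin_ext (coords_lincomb _ (alphaE i j)). Qed.

Lemma env_relation_homog x :
  env_relation d alpha x -> exists g, rel_comp d g x.
Proof.
case=> i [j ->]; exists (d i * d j)%g; rewrite -(lin_ext_lie (rel_var F d)).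
have gR := (relFree_in_variety F d).1.1.
apply: (gradingB gR).
  by apply: (in_variety_commutator (relFree_in_variety F d)); apply: rel_comp_var.
apply: (lin_ext_graded gL.1 basis_e ed gR); first exact: rel_comp_var.
exact: gL.2.
Qed.

Lemma env_in_variety : in_variety (env_comp (F := F) d alpha).
Proof.
have [[gR mulR] vR] := relFree_in_variety F d.
apply: quot_in_variety.
  apply: (quot_graded_alg mulR (gen_ideal_graded gR mulR env_relation_homog)).
by move=> g h gh a b ag bh; rewrite (vR g h) // rpred0.
Qed.

Lemma env_var_comp i : env_comp d alpha (d i) (env_var d alpha i).
Proof. by exists (rel_var F d i) => //; apply: rel_comp_var. Qed.

Lemma env_iota_bracket : {morph env_iota : x y / lie x y >-> commutator x y}.
Proof.
have li : linear env_iota by apply: lin_ext_linear.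
have [lc [c1 cM]] := cls_hom (env_ideal d alpha).
apply: (lie_morph_basis basis_e li).
move=> i j; rewrite /env_iota lin_ext_lie !lin_ext_basis.
apply/esym/eqP; rewrite -subr_eq0; apply/eqP.
rewrite /commutator /env_var.
under eq_bigr do rewrite -(linZ lc).
rewrite -(lin_sum lc) -!cM -!(linB lc); apply: cls0; apply: gen_ideal_incl.
by exists i, j.
Qed.

Lemma env_strong_pair : strong_pair L_ (env_comp d alpha) env_iota.
Proof.
have vU := env_in_variety; split; last exact: in_variety_commutator.
split=> //; first exact: vU.1.
- exact: lin_ext_linear.
- exact: (lin_ext_graded gL.1 basis_e ed vU.1.1 env_var_comp).
- exact: env_iota_bracket.
Qed.

Lemma env_hom_uniq (A : unitalAlgType F) (f f' : U -> A) :
  alg_hom f -> alg_hom f' ->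
  (forall i, f (env_var d alpha i) = f' (env_var d alpha i)) -> f =1 f'.
Proof.
move=> hf hf' ff' u; have [r ->] := cls_surj u; have [p ->] := cls_surj r.
have hc : alg_hom (cls (env_ideal d alpha) \o cls (variety_ideal d)).
  by apply: alg_hom_comp; apply: cls_hom.
exact: (free_hom_uniq (alg_hom_comp hf hc) (alg_hom_comp hf' hc)).
Qed.

(** Stated for a bracket-preserving graded map from [L] to an algebra of the
    variety; the maps to other strong pairs in the universal property are
    composites of this form. *)
Lemma env_lift (A : unitalAlgType F) (A_ : G -> A -> Prop) (lambda : L -> A) :
  in_variety A_ -> linear lambda -> graded_map L_ A_ lambda ->
  {morph lambda : x y / lie x y >-> commutator x y} ->
  exists f : U -> A, [/\ alg_hom f, graded_map (env_comp d alpha) A_ f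
    & forall x, f (env_iota x) = lambda x].
Proof.
move=> vA ll gl lB.
have [f [hf gf fv]] := relFree_lift vA (fun i => gl _ _ (ed i)).
have [fU hfU fUK] : exists2 fU : U -> A, alg_hom fU &
    forall x, fU (cls (env_ideal d alpha) x) = f x.
  apply: quot_lift => //; apply: gen_ideal_ker => // _ [i [j ->]].
  have [lf [f1 fM]] := hf.
  rewrite !(linB lf) !fM !fv (lin_sum lf).
  under eq_bigr do rewrite (linZ lf) fv.
  apply/eqP; rewrite -/(commutator _ _) -lB subr_eq0 alphaE (lin_sum ll).
  by apply/eqP/eq_bigr => k _; rewrite (linZ ll).
exists fU; split=> // [g _ [x xg ->]|]; first by rewrite fUK; apply: gf.
apply: (eq_linear_basis basis_e) => // [c x y|i].
  by rewrite /env_iota lin_ext_linear hfU.1.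
by rewrite /env_iota lin_ext_basis fUK fv.
Qed.

Lemma env_universal :
  strong_universal_enveloping L_ (env_comp d alpha) env_iota.
Proof.
split; first exact: env_strong_pair.
move=> H H_ A A_ kappa [[_ gA lk gk kB] sA] phi [lphi phiB] gphi.
have [||||f [hf gf fK]] := @env_lift A A_ (kappa \o phi).
- exact: strong_in_variety.
- by move=> c x y; rewrite /= lphi lk.
- by move=> g x /gphi/gk.
- by move=> x y; rewrite /= phiB kB.
exists f; split=> // f' [hf' _ f'K].
apply/funext/env_hom_uniq => // i.
by rewrite -(lin_ext_basis basis_e (env_var d alpha) i) fK f'K.
Qed.

End Enveloping.

Theorem theorem12 (G : groupType) (F : fieldType)
  (L : lieAlgType F) (L_ : G -> L -> Prop)
  (N : choiceType) (e : N -> L) (d : N -> G)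
  (alpha : N -> N -> {fsfun N -> F with 0}) :
  graded_lie L_ ->
  is_basis e ->
  (forall i, L_ (d i) (e i)) ->
  (forall i j,
     lie (e i) (e j) = \sum_(k <- finsupp (alpha i j)) alpha i j k *: e k) ->
  exists iota : L -> envAlg d alpha,
    [/\ linear iota, (forall i, iota (e i) = env_var d alpha i)
      & strong_universal_enveloping L_ (env_comp d alpha) iota].
Proof.
move=> gL basis_e ed alphaE; exists (env_iota d alpha basis_e); split.
- exact: lin_ext_linear.
- exact: lin_ext_basis.
- exact: env_universal.
Qed.
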